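(* Let $|q|<1$. The Fock representation of the $C^*$-algebra $\mathcal{O}_2^q$ is faithful.
   Context: For $|q|<1$, $\mathcal{O}_2^q$ denotes the universal unital $C^*$-algebra generated by two isometries $s_1,s_2$ (i.e. $s_1^*s_1=s_2^*s_2=1$) satisfying the relation $s_1^*s_2=q\,s_2s_1^*$. The Fock representation of $\mathcal{O}_2^q$ is the (unique up to unitary equivalence) irreducible $*$-representation on a Hilbert space which has a nonzero (vacuum) vector $\Omega$ with $s_i^*\Omega=0$ for $i=1,2$. *)

(* Defs.v *)
From HB Require Import structures.
From mathcomp Require Import all_boot all_order all_algebra sesquilinear.
From mathcomp Require Import complex.
From mathcomp Require Import all_classical all_reals all_analysis.

Set Implicit Arguments.
Unset Strict Implicit.
Unset Printing Implicit Defensive.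

Import Order.TTheory GRing.Theory Num.Theory.
Import numFieldNormedType.Exports.
Local Open Scope classical_set_scope.
Local Open Scope ring_scope.

(* Unital C*-algebras over R[i], in two steps: first the normed *-algebra with
   the C*-identity, then completeness.  Unitality and 1 != 0 come from
   [GRing.Algebra]; excluding the zero algebra does not change any universal
   property, since there is exactly one map into it.  As elsewhere for normed
   modules over R[i], the norm takes its (nonnegative real) values in R[i]. *)
HB.mixin Record Algebra_isPreCStarAlgebra (R : realType) A
    of GRing.Algebra R[i] A := {
  cnorm : A -> R[i] ;
  cnormD : forall a b : A, cnorm (a + b) <= cnorm a + cnorm b ;
  cnormZ : forall (c : R[i]) (a : A), cnorm (c *: a) = `|c| * cnorm a ;
  cnorm0_eq0 : forall a : A, cnorm a = 0 -> a = 0 ;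
  cnormM : forall a b : A, cnorm (a * b) <= cnorm a * cnorm b ;
  star : A -> A ;
  starK : involutive star ;
  star_semilinear : forall (c : R[i]) (a b : A),
    star (c *: a + b) = Num.conj c *: star a + star b ;
  starM : forall a b : A, star (a * b) = star b * star a ;
  cstar_identity : forall a : A, cnorm (star a * a) = cnorm a ^+ 2
}.

#[short(type="preCStarAlgebraType")]
HB.structure Definition PreCStarAlgebra (R : realType) :=
  {A of GRing.Algebra R[i] A & Algebra_isPreCStarAlgebra R A}.

(* The library hierarchy has no join of (noncommutative) algebras with normed
   modules, and none can be added since [Num.NumDomain] already lies below
   both; so the topology of A is carried by the synonym [normed_space A]. *)
Definition normed_space (R : realType) (A : preCStarAlgebraType R) : Type := A.

HB.instance Definition _ (R : realType) (A : preCStarAlgebraType R) :=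
  GRing.Lmodule.copy (normed_space A) A.
HB.instance Definition _ (R : realType) (A : preCStarAlgebraType R) :=
  @Lmodule_isNormed.Build R[i] (normed_space A) (@cnorm R A)
    cnormD cnormZ cnorm0_eq0.

HB.mixin Record PreCStarAlgebra_isComplete (R : realType) A
    of PreCStarAlgebra R A := {
  cstar_complete : forall F : set_system (normed_space A),
    ProperFilter F -> cauchy F -> cvg F
}.

#[short(type="cstarAlgebraType")]
HB.structure Definition CStarAlgebra (R : realType) :=
  {A of PreCStarAlgebra R A & PreCStarAlgebra_isComplete R A}.

HB.instance Definition _ (R : realType) (A : cstarAlgebraType R) :=
  Uniform_isComplete.Build (normed_space A) (@cstar_complete R A).

(* The inner product is linear in its first argument, as in [{dot _ for _}]. *)
HB.mixin Record CompleteNormedModule_isHilbert (R : realType) H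
    of CompleteNormedModule R[i] H := {
  inner : {dot H for (@Num.conj R[i])} ;
  inner_norm : forall x : H, `|x| ^+ 2 = inner x x
}.

#[short(type="hilbertType")]
HB.structure Definition Hilbert (R : realType) :=
  {H of CompleteNormedModule R[i] H & CompleteNormedModule_isHilbert R H}.

Section Universal.
Variables (R : realType) (q : R[i]).

Definition q_isometries (A : cstarAlgebraType R) (s1 s2 : A) : Prop :=
  [/\ star s1 * s1 = 1, star s2 * s2 = 1 &
      star s1 * s2 = q *: (s2 * star s1)].

Definition cstar_subalgebra (A : cstarAlgebraType R) (S : set A) : Prop :=
  [/\ closed (S : set (normed_space A)), S 1,
      (forall (c : R[i]) a b, S a -> S b -> S (c *: a + b)),
      (forall a b, S a -> S b -> S (a * b)) &
      (forall a, S a -> S (star a))].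

Definition cstar_generated (A : cstarAlgebraType R) (s1 s2 : A) : Prop :=
  forall S : set A, cstar_subalgebra S -> S s1 -> S s2 -> S = setT.

Definition star_preserving (A B : cstarAlgebraType R) (f : A -> B) : Prop :=
  forall a, f (star a) = star (f a).

(* (A, s1, s2) is the universal C*-algebra O_2^q, which its universal property
   determines up to isomorphism. *)
Definition is_O2q (A : cstarAlgebraType R) (s1 s2 : A) : Prop :=
  [/\ q_isometries s1 s2, cstar_generated s1 s2 &
      forall (B : cstarAlgebraType R) (t1 t2 : B), q_isometries t1 t2 ->
        exists f : {lrmorphism A -> B},
          [/\ star_preserving f, f s1 = t1, f s2 = t2 &
              forall g : {lrmorphism A -> B},
                star_preserving g -> g s1 = t1 -> g s2 = t2 -> g =1 f]].

End Universal.

Section Representations.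
Variables (R : realType) (A : cstarAlgebraType R) (H : hilbertType R).

(* Unitality is part of the definition: otherwise the zero map on a
   one-dimensional space would be an irreducible representation. *)
Record star_representation (pi : A -> H -> H) : Prop := {
  star_rep_linear : forall a, linear (pi a) ;
  star_rep_continuous : forall a, continuous (pi a) ;
  star_rep_lin : forall (c : R[i]) a b x,
    pi (c *: a + b) x = c *: pi a x + pi b x ;
  star_rep_mul : forall a b x, pi (a * b) x = pi a (pi b x) ;
  star_rep_one : forall x, pi 1 x = x ;
  star_rep_adjoint : forall a x y,
    inner (pi a x) y = inner x (pi (star a) y)
}.

Definition closed_subspace (E : set H) : Prop :=
  [/\ closed E, E 0 &
      forall (c : R[i]) x y, E x -> E y -> E (c *: x + y)].

Definition invariant_under (pi : A -> H -> H) (E : set H) : Prop :=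
  forall a x, E x -> E (pi a x).

Definition irreducible_rep (pi : A -> H -> H) : Prop :=
  (exists x : H, x != 0) /\
  forall E : set H, closed_subspace E -> invariant_under pi E ->
    E = [set 0] \/ E = setT.

Definition is_Fock_representation (s1 s2 : A) (pi : A -> H -> H) : Prop :=
  [/\ star_representation pi, irreducible_rep pi &
      exists Omega : H,
        [/\ Omega != 0, pi (star s1) Omega = 0 & pi (star s2) Omega = 0]].

Definition faithful_rep (pi : A -> H -> H) : Prop := injective pi.

End Representations.

(* Main.v *)
Require Import Defs.
From HB Require Import structures.
From mathcomp Require Import all_boot all_order all_algebra sesquilinear.
From mathcomp Require Import complex.
From mathcomp Require Import all_classical all_reals all_analysis.
From mathcomp Require Import ring lra.
Import Order.TTheory GRing.Theory Num.Theory.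
Import numFieldNormedType.Exports.
Import Normc.
Local Open Scope classical_set_scope.
Local Open Scope ring_scope.

Set Implicit Arguments.
Unset Strict Implicit.
Unset Printing Implicit Defensive.

(* With P = s1 s1^*, the isometries t1 = s1 and t2 = (1 - P) s2 (1 - |q|^2 P)^(-1/2) have orthogonal
   ranges, generate the same C*-algebra (s2 is the limit of a contraction with coefficients in t1
   and t2) and have the same vacuum vectors.  So it is enough to treat q = 0.

   Let p be a combination of the t_u t_v^* with words u, v of length at most n, and suppose that
   pi(p) is bounded by m.  The blocks of pi(p) between the levels of Fock space are bounded by m;
   they determine the bihomogeneous parts of p, each of which lives in a finite matrix algebra
   inside A, and this gives the crude bound ||p|| <= 2 (n + 1)^2 m.  Since (p^* p)^(2^k) has degree
   at most 2^k * 2n, the C*-identity ||p||^(2^(k+1)) = ||(p^* p)^(2^k)|| and the polynomial growth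
   of the crude bound improve it to ||p|| <= m as k grows.  Such p are dense and pi is contractive,
   so pi is isometric. *)

(** * Growth of powers of real numbers *)

Section RealPowers.
Variable R : realType.
Implicit Types x y c d m e r : R.

Lemma exists_geometric_lt c r e : 0 <= r -> r < 1 -> 0 < e ->
  exists N, forall n, (N <= n)%N -> c * r ^+ n < e.
Proof.
move=> r0 r1 e0.
have [c0|c0] := leP c 0.
  exists 0 => n _; apply: le_lt_trans e0.
  by rewrite mulr_le0_ge0 ?exprn_ge0.
have /cvgrPdist_lt/(_ (e / c)) H : (fun n => r ^+ n) @ \oo --> (0 : R).
  by apply: cvg_expr; rewrite ger0_norm.
have [|N _ HN] := H; first by rewrite divr_gt0.
exists N => n nN; have := HN n nN; rewrite /= sub0r normrN ger0_norm ?exprn_ge0//.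
by rewrite ltr_pdivlMr// mulrC.
Qed.

(** For [y > 1] the doubly exponential [y ^+ (2 ^ k)] outgrows every [c * d ^+ k]. *)
Lemma le1_of_power_bound y c d : 1 <= d -> 0 <= y ->
  (forall k, y ^+ (2 ^ k) <= c * d ^+ k) -> y <= 1.
Proof.
move=> d1 y0 H; rewrite leNgt; apply/negP => y1.
have d0 : 0 < d by apply: lt_le_trans d1.
(* Once [y ^+ (2 ^ K) >= 2 * d], the left side at [k = K + N] is at least [(2 * d) ^+ N], and
   [2 ^+ N] eventually exceeds [c * d ^+ K]. *)
have [K HK] : exists K, 2 * d <= y ^+ K.
  have [|||N /(_ N (leqnn N)) hN] := @exists_geometric_lt (2 * d) y^-1 1.
  - by rewrite invr_ge0.
  - by rewrite invf_lt1// (lt_trans ltr01).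
  - by [].
  exists N; move: hN; rewrite exprVn ltr_pdivrMr ?mul1r; first exact: ltW.
  by rewrite exprn_gt0// (lt_trans ltr01).
have {}HK : 2 * d <= y ^+ (2 ^ K).
  apply: le_trans HK _; rewrite ler_weXn2l//; first exact: ltW.
  exact/ltnW/ltn_expl.
have [|||N /(_ N (leqnn N))] := @exists_geometric_lt (c * d ^+ K) 2^-1 1.
- by rewrite invr_ge0.
- by rewrite invf_lt1// ltr1n.
- by [].
rewrite exprVn ltr_pdivrMr ?exprn_gt0// mul1r => h.
have := H (K + N)%N; rewrite expnD exprM exprD leNgt => /negP; apply.
apply: (@lt_le_trans _ _ ((2 * d) ^+ N)).
  by rewrite exprMn mulrA ltr_pM2r ?exprn_gt0.
apply: (@le_trans _ _ ((2 * d) ^+ (2 ^ N))).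
  rewrite ler_weXn2l//; first lra.
  exact/ltnW/ltn_expl.
by rewrite lerXn2r ?nnegrE ?exprn_ge0//; lra.
Qed.

Lemma le_of_power_bound x m c d : 1 <= d -> 0 <= x -> 0 <= m ->
  (forall k, x ^+ (2 ^ k) <= c * d ^+ k * m ^+ (2 ^ k)) -> x <= m.
Proof.
move=> d1 x0; rewrite le_eqVlt => /predU1P[<-|m0] H.
  by have := H 0; rewrite expn0 !expr1 mulr0.
rewrite -[leRHS]mul1r -ler_pdivrMr//.
apply: (@le1_of_power_bound _ c d) => //; first by rewrite divr_ge0// ltW.
by move=> k; rewrite expr_div_n ler_pdivrMr ?exprn_gt0.
Qed.

End RealPowers.

(** * Norm, involution and square roots in a C*-algebra *)

Section CStarBasics.
Variables (R : realType) (A : cstarAlgebraType R).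
Implicit Types (a b : A) (c : R[i]).

(** Taking values in [R] instead of [R[i]] gives a total order and access to real arithmetic. *)
Definition rnorm a : R := complex.Re (cnorm a).

Lemma rnormE a : cnorm a = (rnorm a)%:C%C.
Proof.
rewrite /rnorm RRe_real//; apply: ger0_real.
exact: (@normr_ge0 _ (normed_space A) a).
Qed.

Lemma rnorm_ge0 a : 0 <= rnorm a.
Proof. rewrite -lecR -rnormE; exact: (@normr_ge0 _ (normed_space A) a). Qed.

Lemma rnormD a b : rnorm (a + b) <= rnorm a + rnorm b.
Proof. by rewrite -lecR rmorphD/= -!rnormE cnormD. Qed.

Lemma normcC c : `|c| = (normc c)%:C%C.
Proof. by []. Qed.

Lemma rnormZ c a : rnorm (c *: a) = normc c * rnorm a.
Proof. by apply: complexI; rewrite rmorphM/= -!rnormE cnormZ normcC. Qed.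

Lemma rnormM a b : rnorm (a * b) <= rnorm a * rnorm b.
Proof. by rewrite -lecR rmorphM/= -!rnormE cnormM. Qed.

Lemma rnorm_cstar a : rnorm (star a * a) = rnorm a ^+ 2.
Proof. by apply: complexI; rewrite rmorphXn/= -!rnormE cstar_identity. Qed.

Lemma rnorm0_eq0 a : rnorm a = 0 -> a = 0.
Proof. by move=> a0; apply: cnorm0_eq0; rewrite rnormE a0. Qed.

Lemma rnorm0 : rnorm 0 = 0.
Proof. by rewrite -(scale0r (0 : A)) rnormZ normc0 mul0r. Qed.

Lemma rnormN a : rnorm (- a) = rnorm a.
Proof.
rewrite -scaleN1r rnormZ; suff -> : normc (-1 : R[i]) = 1 by rewrite mul1r.
by apply: complexI; rewrite -normcC normrN1.
Qed.

Lemma rnormB a b : rnorm (a - b) <= rnorm a + rnorm b.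
Proof. by rewrite -(rnormN b) rnormD. Qed.

Lemma rnorm_sum I (r : seq I) (F : I -> A) :
  rnorm (\sum_(i <- r) F i) <= \sum_(i <- r) rnorm (F i).
Proof.
apply: (big_ind2 (fun a x => rnorm a <= x)) => //; first by rewrite rnorm0.
by move=> a x b y ax bY; apply: le_trans (rnormD _ _) _; rewrite lerD.
Qed.

Lemma starD : {morph @star R A : a b / a + b}.
Proof.
by move=> a b; rewrite -[a]scale1r star_semilinear rmorph1 !scale1r.
Qed.

Lemma star0 : star 0 = 0 :> A.
Proof. by apply: (addrI (star 0)); rewrite -starD !addr0. Qed.

Lemma starZ c a : star (c *: a) = c^* *: star a.
Proof. by rewrite -[c *: a]addr0 star_semilinear star0 addr0. Qed.

Lemma starN a : star (- a) = - star a.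
Proof. by apply: (addrI (star a)); rewrite -starD !subrr star0. Qed.

Lemma starB a b : star (a - b) = star a - star b.
Proof. by rewrite starD starN. Qed.

Lemma star1 : star 1 = 1 :> A.
Proof. by have := starM 1 (star 1 : A); rewrite mul1r !starK mul1r => <-. Qed.

Lemma star_sum I (r : seq I) (F : I -> A) :
  star (\sum_(i <- r) F i) = \sum_(i <- r) star (F i).
Proof. exact: (big_morph _ starD star0). Qed.

Lemma starX a n : star (a ^+ n) = star a ^+ n.
Proof. by elim: n => [|n IH]; rewrite ?star1// exprS exprSr starM IH. Qed.

(** The C*-identity and submultiplicativity give [rnorm b ^+ 2 <= rnorm (star b) * rnorm b]; this is
    applied to [a] and to [star a]. *)
Lemma rnorm_star a : rnorm (star a) = rnorm a.
Proof.
suff H b : rnorm b <= rnorm (star b).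
  by apply/eqP; rewrite eq_le H -{2}[a]starK H.
have [b0|b0] := eqVneq (rnorm b) 0; first by rewrite b0 rnorm_ge0.
have bp : 0 < rnorm b by rewrite lt_def b0 rnorm_ge0.
by rewrite -(ler_pM2r bp) -expr2 -rnorm_cstar rnormM.
Qed.

Lemma rnorm_le1_of_idem a : star a * a = a -> rnorm a <= 1.
Proof.
move=> aa; have [->//|a0] := eqVneq (rnorm a) 0.
have ap : 0 < rnorm a by rewrite lt_def a0 rnorm_ge0.
by rewrite -(ler_pM2r ap) mul1r -expr2 -rnorm_cstar aa.
Qed.

Lemma rnorm_isometry a : star a * a = 1 -> rnorm a <= 1.
Proof.
move=> a1; rewrite -(@ler_pXn2r _ 2) ?nnegrE ?rnorm_ge0 ?ler01//.
by rewrite -rnorm_cstar a1 expr1n rnorm_le1_of_idem// star1 mul1r.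
Qed.

Lemma rnorm_pow2 a k : star a = a -> rnorm (a ^+ (2 ^ k)) = rnorm a ^+ (2 ^ k).
Proof.
move=> aa; elim: k => [//|k IH].
by rewrite expnS mulnC !exprM expr2 -{1}aa -starX rnorm_cstar IH.
Qed.

(** By the C*-identity the left side equals [(rnorm a ^+ 2) ^+ (2 ^ k)], so a loss of only
    [k0 * d ^+ k] disappears after taking roots of order [2 ^ k]. This is what turns crude bounds
    into sharp ones. *)
Lemma rnorm_le_of_powers a (m k0 d : R) : 1 <= d -> 0 <= m ->
  (forall k, rnorm ((star a * a) ^+ (2 ^ k)) <= k0 * d ^+ k * (m ^+ 2) ^+ (2 ^ k)) ->
  rnorm a <= m.
Proof.
move=> d1 m0 H.
rewrite -(@ler_pXn2r _ 2) ?nnegrE ?rnorm_ge0//.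
apply: (@le_of_power_bound _ _ _ k0 d) => //; rewrite ?exprn_ge0 ?rnorm_ge0//.
by move=> k; rewrite -rnorm_cstar -rnorm_pow2// starM starK.
Qed.

Lemma geometric_cauchy_cvg (u : nat -> A) (c r : R) : 0 <= r -> r < 1 ->
  (forall n, rnorm (u n.+1 - u n) <= c * r ^+ n) ->
  exists l, forall e, 0 < e -> exists N, forall n, (N <= n)%N -> rnorm (l - u n) < e.
Proof.
move=> r0 r1 H.
have c0 : 0 <= c by have := le_trans (rnorm_ge0 _) (H 0); rewrite mulr1.
have H2 n m : rnorm (u (n + m)%N - u n) <= c / (1 - r) * r ^+ n.
  (* The factor [1 - r ^+ m] gives the exact partial sum of the geometric series, so that the
     induction on [m] closes. *)
  suff : rnorm (u (n + m)%N - u n) <= c / (1 - r) * r ^+ n * (1 - r ^+ m).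
    move/le_trans; apply; rewrite ler_piMr//.
      by rewrite !mulr_ge0 ?invr_ge0 ?exprn_ge0// subr_ge0 ltW.
    by rewrite gerBl exprn_ge0.
  elim: m => [|m IH]; first by rewrite addn0 !subrr rnorm0 mulr0.
  rewrite -[_ - u n](subrKA (u (n + m)%N)).
  apply: le_trans (rnormD _ _) _.
  rewrite addnS; apply: le_trans (lerD (H _) IH) _.
  rewrite le_eqVlt; apply/orP; left; apply/eqP.
  rewrite exprD exprS; field.
  by lra.
pose F : set_system (normed_space A) := (u : nat -> normed_space A) @ \oo.
have : cvg F.
  apply: cstar_complete.
  apply/cauchy_ballP => e e0; near_simpl.
  have eR : e = (complex.Re e)%:C%C by rewrite RRe_real// gtr0_real.
  have e0' : 0 < complex.Re e / 2 by rewrite divr_gt0// -ltcR -eR.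
  have [N HN] := exists_geometric_lt (c / (1 - r)) r0 r1 e0'.
  exists ([set n | N <= n], [set n | N <= n])%N; first by split; exists N.
  move=> [n m] [/= Nn Nm]; rewrite -ball_normE/= eR.
  change (cnorm (u n - u m) < (complex.Re e)%:C%C); rewrite rnormE ltcR.
  rewrite -[u n - u m](subrKA (u N)) (splitr (complex.Re e)).
  apply: le_lt_trans (rnormD _ _) _; apply: ltrD.
    by rewrite -(subnKC Nn); apply: le_lt_trans (H2 _ _) _; exact: HN.
  rewrite -opprB rnormN.
  by rewrite -(subnKC Nm); apply: le_lt_trans (H2 _ _) _; exact: HN.
move=> /cvg_ex[l Fl]; exists l => e e0.
have /cvgrPdist_lt/(_ e%:C%C) := Fl; rewrite ltcR => /(_ e0)[N _ HN].
exists N => n /HN /=.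
by change (cnorm (l - u n) < e%:C%C -> rnorm (l - u n) < e); rewrite rnormE ltcR.
Unshelve. all: end_near.
Qed.

(* The Banach fixed point of [f |-> (b + f^2)/2] on the ball of radius [r]. *)
Lemma one_minus_square_root b r : star b = b -> rnorm b <= r -> r < 1 ->
  exists f, star f = f /\ 1 - b = (1 - f) * (1 - f).
Proof.
move=> bb br r1.
have r0 : 0 <= r by apply: le_trans br; exact: rnorm_ge0.
pose g f := 2^-1 *: (b + f * f) : A.
have n2 : normc (2^-1 : R[i]) = 2^-1.
  apply: complexI; rewrite -normcC ger0_norm ?invr_ge0//.
  by rewrite fmorphV/= rmorph_nat.
have gr f : rnorm f <= r -> rnorm (g f) <= r.
  move=> fr; rewrite rnormZ n2.
  have : rnorm (b + f * f) <= r + r * r.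
    apply: le_trans (rnormD _ _) _; apply: lerD => //.
    by apply: le_trans (rnormM _ _) _; rewrite ler_pM ?rnorm_ge0.
  have := rnorm_ge0 f; nra.
have gc f h : rnorm f <= r -> rnorm h <= r -> rnorm (g f - g h) <= r * rnorm (f - h).
  move=> fr hr; rewrite -scalerBr rnormZ n2.
  have -> : b + f * f - (b + h * h) = f * (f - h) + (f - h) * h.
    by rewrite mulrBr mulrBl addrA subrK opprD addrACA subrr add0r.
  have := rnormD (f * (f - h)) ((f - h) * h).
  have := rnormM f (f - h); have := rnormM (f - h) h.
  have := rnorm_ge0 (f - h); nra.
pose u n := iter n g 0.
have ur n : rnorm (u n) <= r by elim: n => [|n IH]; rewrite ?rnorm0//=; exact: gr.
have uu n : rnorm (u n.+1 - u n) <= rnorm (u 1%N) * r ^+ n.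
  elim: n => [|n IH]; first by rewrite subr0 mulr1.
  apply: le_trans (gc (u n.+1) (u n) (ur _) (ur _)) _.
  by rewrite exprS mulrCA ler_wpM2l.
have [f Hf] := geometric_cauchy_cvg r0 r1 uu.
have fr : rnorm f <= r.
  apply/ler_addgt0Pr => e /Hf[N /(_ N (leqnn N)) h].
  by rewrite -[f](subrK (u N)); apply: le_trans (rnormD _ _) _; rewrite addrC lerD// ltW.
have fix_f : f = g f.
  apply/eqP; rewrite -subr_eq0; apply/eqP/rnorm0_eq0/eqP.
  rewrite eq_le rnorm_ge0 andbT; apply/ler_addgt0Pr => e e0; rewrite add0r.
  have [|N HN] := Hf (e / 2); first by rewrite divr_gt0.
  have h1 := HN _ (leqnn N); have h2 := HN _ (leqnSn N).
  rewrite -(subrKA (u N.+1)) (splitr e).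
  apply: le_trans (rnormD _ _) _; apply: lerD; first exact: ltW.
  rewrite -opprB rnormN; apply: le_trans (gc _ _ fr (ur _)) _.
  apply: le_trans (ltW h1); rewrite ler_piMl ?rnorm_ge0//; exact: ltW.
have gs h : star (g h) = g (star h).
  rewrite starZ starD starM bb; congr (_ *: _).
  by rewrite fmorphV/= rmorph_nat.
(* [star f] is also a fixed point of [g] in the ball, and [g] contracts by [r < 1] there. *)
have sf : star f = f.
  apply/eqP; rewrite -subr_eq0; apply/eqP/rnorm0_eq0/eqP.
  have := gc (star f) f; rewrite rnorm_star -gs -fix_f => /(_ fr fr).
  have := rnorm_ge0 (star f - f) => h0 h.
  by rewrite eq_le h0 andbT; nra.
exists f; split => //.
rewrite mulrBr mulr1 mulrBl mul1r.
have -> : b = f + f - f * f.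
  have : 2 *: f = b + f * f by rewrite {1}fix_f scalerA mulfV ?scale1r// pnatr_eq0.
  by rewrite scaler_nat mulr2n => ->; rewrite addrK.
by rewrite -addrA opprD addrA.
Qed.

End CStarBasics.

(** * Hilbert space representations *)

Section HilbertBasics.
Variables (R : realType) (H : hilbertType R).
Implicit Types (x y : H) (c : R[i]).

Definition vnorm x : R := complex.Re `|x|.

Lemma vnormE x : `|x| = (vnorm x)%:C%C.
Proof. by rewrite /vnorm RRe_real// ger0_real. Qed.

Lemma vnorm_ge0 x : 0 <= vnorm x.
Proof. by rewrite -lecR -vnormE; exact: normr_ge0. Qed.

Lemma vnorm_eq0 x : vnorm x = 0 -> x = 0.
Proof. by move=> x0; apply/normr0_eq0; rewrite vnormE x0. Qed.

Lemma vnorm0 : vnorm 0 = 0.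
Proof. by rewrite /vnorm normr0. Qed.

Lemma vnormZ c x : vnorm (c *: x) = normc c * vnorm x.
Proof. by apply: complexI; rewrite rmorphM/= -!vnormE normrZ normcC. Qed.

Lemma inner_vnorm x : inner x x = ((vnorm x) ^+ 2)%:C%C.
Proof. by rewrite rmorphXn/= -vnormE inner_norm. Qed.

Lemma innerC x y : inner x y = (inner y x)^*.
Proof. by rewrite hermC expr0 mul1r. Qed.

Lemma innerZl c x y : inner (c *: x) y = c * inner x y.
Proof. exact: linearZl_LR. Qed.

Lemma innerZr c x y : inner x (c *: y) = c^* * inner x y.
Proof. by rewrite innerC innerZl rmorphM/= -innerC. Qed.

Lemma innerDl x y z : inner (x + y) z = inner x z + inner y z.
Proof. exact: linearDl. Qed.

Lemma innerBl x y z : inner (x - y) z = inner x z - inner y z.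
Proof. exact: linearBl. Qed.

Lemma innerBr x y z : inner x (y - z) = inner x y - inner x z.
Proof. exact: linearBr. Qed.

Lemma inner0l x : inner 0 x = 0.
Proof. exact: linear0l. Qed.

Lemma inner0r x : inner x 0 = 0.
Proof. exact: linear0r. Qed.

Lemma inner_suml J (r : seq J) (F : J -> H) y :
  inner (\sum_(i <- r) F i) y = \sum_(i <- r) inner (F i) y.
Proof. exact: linear_sumlz. Qed.

Lemma inner_sumr J (r : seq J) (F : J -> H) y :
  inner y (\sum_(i <- r) F i) = \sum_(i <- r) inner y (F i).
Proof. exact: linear_sumr. Qed.

Lemma cauchy_schwarz x y : normc (inner x y) <= vnorm x * vnorm y.
Proof.
have [y0|y0] := eqVneq (vnorm y) 0.
  by rewrite (vnorm_eq0 y0) inner0r normc0 vnorm0 mulr0.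
have yp : 0 < vnorm y by rewrite lt_def y0 vnorm_ge0.
have n0 : 0 <= normc (inner x y) by rewrite -lecR -normcC normr_ge0.
rewrite -(@ler_pXn2r _ 2) ?nnegrE ?mulr_ge0 ?vnorm_ge0//.
(* The squared norm of [Y *: x - inner x y *: y] is [Y] times the difference of the two squared
   sides; scaling by [Y] avoids a division. *)
pose Y := (vnorm y ^+ 2)%:C%C : R[i].
have YJ : Y^* = Y by apply/CrealP/complex_realP; exists (vnorm y ^+ 2).
have : 0 <= inner (Y *: x - inner x y *: y) (Y *: x - inner x y *: y).
  by rewrite inner_vnorm ler0c exprn_ge0 ?vnorm_ge0.
rewrite innerBl !innerBr !innerZl !innerZr YJ -/(inner y x) (innerC y x).
rewrite !inner_vnorm -/Y.
have -> : Y * (Y * (vnorm x ^+ 2)%:C%C) - Y * ((inner x y)^* * inner x y)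
    - (inner x y * (Y * (inner x y)^*) - inner x y * ((inner x y)^* * Y))
  = Y * (Y * (vnorm x ^+ 2)%:C%C - (inner x y * (inner x y)^* )) by ring.
rewrite -normCK normcC -!rmorphXn -!rmorphM -rmorphB/= -rmorphM ler0c.
rewrite pmulr_rge0 ?exprn_gt0// subr_ge0 exprMn.
by rewrite [leRHS]mulrC.
Qed.

End HilbertBasics.

Section Representations.
Variables (R : realType) (A : cstarAlgebraType R) (H : hilbertType R).
Variables (pi : A -> H -> H) (pi_rep : star_representation pi).
Implicit Types (a b : A) (x y : H) (c : R[i]) (m : R).

(** The bound on the operator norm of [pi a], stated pointwise so that no supremum has to be
    formed. *)
Definition rep_bound a m := forall x, vnorm (pi a x) <= m * vnorm x.

Lemma pi_vlin a c x y : pi a (c *: x + y) = c *: pi a x + pi a y.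
Proof. exact: star_rep_linear. Qed.

Lemma pi_vD a x y : pi a (x + y) = pi a x + pi a y.
Proof. by have := pi_vlin a 1 x y; rewrite !scale1r. Qed.

Lemma pi_v0 a : pi a 0 = 0.
Proof. by apply: (addrI (pi a 0)); rewrite -pi_vD !addr0. Qed.

Lemma pi_vZ a c x : pi a (c *: x) = c *: pi a x.
Proof. by rewrite -[c *: x]addr0 pi_vlin pi_v0 addr0. Qed.

Lemma piD a b x : pi (a + b) x = pi a x + pi b x.
Proof. by have := star_rep_lin pi_rep 1 a b x; rewrite !scale1r. Qed.

Lemma pi0 x : pi 0 x = 0.
Proof. by apply: (addrI (pi 0 x)); rewrite -piD !addr0. Qed.

Lemma piZ c a x : pi (c *: a) x = c *: pi a x.
Proof. by rewrite -[c *: a]addr0 star_rep_lin// pi0 addr0. Qed.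

Lemma piN a x : pi (- a) x = - pi a x.
Proof. by apply: (addrI (pi a x)); rewrite -piD !subrr pi0. Qed.

Lemma piB a b x : pi (a - b) x = pi a x - pi b x.
Proof. by rewrite piD piN. Qed.

Lemma pi_sum J (r : seq J) (F : J -> A) x :
  pi (\sum_(i <- r) F i) x = \sum_(i <- r) pi (F i) x.
Proof.
by apply: (big_morph (fun a => pi a x)) => [a b|]; rewrite ?pi0 ?piD.
Qed.

Lemma pi_adjoint a x y : inner (pi a x) y = inner x (pi (star a) y).
Proof. exact: star_rep_adjoint. Qed.

(* If [rnorm d < 1] then [1 - star d * d] is the square of a self-adjoint element, hence is
   mapped to a positive operator. *)
Lemma rep_bound_rnorm a : rep_bound a (rnorm a).
Proof.
move=> x; apply/ler_addgt0Pr => e e0.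
(* A strict inequality allows [a] to be scaled into the open unit ball, where the square root
   exists; the excess [e / (1 + vnorm x)] costs at most [e]. *)
suff H2 m : rnorm a < m -> vnorm (pi a x) <= m * vnorm x.
  have e' : 0 < e / (1 + vnorm x).
    by rewrite divr_gt0// ltr_wpDr ?vnorm_ge0.
  have := H2 (rnorm a + e / (1 + vnorm x)); rewrite ltrDl => /(_ e') /le_trans; apply.
  rewrite mulrDl lerD2l -mulrA ler_piMr//; first exact: ltW.
  rewrite mulrC ler_pdivrMr ?mul1r ?lerDr//.
  by rewrite ltr_wpDr ?vnorm_ge0.
move=> am.
have m0 : 0 < m by apply: le_lt_trans am; exact: rnorm_ge0.
pose d := (m^-1)%:C%C *: a.
have d1 : rnorm (star d * d) < 1.
  rewrite rnorm_cstar -(expr1n _ 2) ltr_pXn2r ?nnegrE ?rnorm_ge0//.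
  rewrite rnormZ.
  have -> : normc (m^-1)%:C%C = m^-1.
    by apply: complexI; rewrite -normcC ger0_norm// ler0c invr_ge0 ltW.
  by rewrite mulrC ltr_pdivrMr// mul1r.
have [|f [ff d2]] := @one_minus_square_root _ _ (star d * d) _ _ (lexx _) d1.
  by rewrite starM starK.
(* The difference of the two sides is [inner x (pi (1 - star d * d) x)], the squared norm of
   [pi (1 - f) x]. *)
have : vnorm (pi d x) ^+ 2 <= vnorm x ^+ 2.
  rewrite -lecR -!inner_vnorm pi_adjoint -star_rep_mul//.
  rewrite -subr_ge0 -innerBr -[X in inner x (X - _)](star_rep_one pi_rep) -piB d2.
  rewrite star_rep_mul//.
  have sf : star (1 - f) = 1 - f by rewrite starB star1 ff.
  by rewrite -{1}sf -pi_adjoint inner_vnorm ler0c exprn_ge0 ?vnorm_ge0.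
rewrite ler_pXn2r ?nnegrE ?vnorm_ge0// piZ vnormZ.
have -> : normc (m^-1)%:C%C = m^-1.
  by apply: complexI; rewrite -normcC ger0_norm// ler0c invr_ge0 ltW.
by rewrite ler_pdivrMl.
Qed.

(** The squared norm of [pi (star a) x] is [inner (pi a (pi (star a) x)) x]; Cauchy-Schwarz and the
    bound on [pi a] leave one factor to cancel. *)
Lemma rep_bound_star a m : rep_bound a m -> rep_bound (star a) m.
Proof.
move=> am x; have [->|h] := eqVneq (vnorm (pi (star a) x)) 0.
  have := am x => /(le_trans (vnorm_ge0 _)) am0.
  by [].
have hp : 0 < vnorm (pi (star a) x) by rewrite lt_def h vnorm_ge0.
rewrite -(ler_pM2r hp) -expr2.
have -> : vnorm (pi (star a) x) ^+ 2 = normc (inner (pi a (pi (star a) x)) x).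
  apply: complexI; rewrite -normcC pi_adjoint -inner_vnorm ger0_norm//.
apply: le_trans (cauchy_schwarz _ _) _.
apply: le_trans (ler_wpM2r (vnorm_ge0 _) (am _)) _.
by rewrite mulrAC.
Qed.

Lemma rep_boundM a b m n : 0 <= m -> rep_bound a m -> rep_bound b n ->
  rep_bound (a * b) (m * n).
Proof.
move=> m0 am bn x; rewrite star_rep_mul//; apply: le_trans (am _) _.
by rewrite -mulrA ler_wpM2l.
Qed.

Lemma rep_boundX a m n : 0 <= m -> rep_bound a m -> rep_bound (a ^+ n) (m ^+ n).
Proof.
move=> m0 am; elim: n => [|n IH].
  by move=> x; rewrite star_rep_one// mul1r.
by rewrite !exprS; apply: rep_boundM.
Qed.

End Representations.

(** * Words in isometries with orthogonal ranges *)

Lemma sum_tuple0 (V : nmodType) (I : finType) (F : seq I -> V) :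
  \sum_(u : 0.-tuple I) F u = F [::].
Proof.
by rewrite (big_pred1 [tuple]) // => u; rewrite [u]tuple0 /= eqxx.
Qed.

Lemma sum_tupleS (V : nmodType) (I : finType) n (F : seq I -> V) :
  \sum_(u : n.+1.-tuple I) F u = \sum_i \sum_(u : n.-tuple I) F (i :: u).
Proof.
rewrite pair_bigA /= (reindex (fun p : I * n.-tuple I => [tuple of p.1 :: p.2])) //.
exists (fun u => (thead u, [tuple of behead u])) => [[i u] _|u _] /=.
  by congr pair; apply: val_inj.
by rewrite [in RHS](tuple_eta u).
Qed.

Section ToeplitzWords.
Variables (R : realType) (A : cstarAlgebraType R) (I : finType) (t : I -> A).
Hypothesis t_orth : forall i j, star (t i) * t j = (i == j)%:R.
Implicit Types (u v w : seq I) (a b : A) (c : R[i]) (P Q S : nat -> nat -> bool).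

Definition word u : A := \prod_(i <- u) t i.

Lemma word_nil : word [::] = 1.
Proof. exact: big_nil. Qed.

Lemma word_cons i u : word (i :: u) = t i * word u.
Proof. exact: big_cons. Qed.

Lemma word_cat u v : word (u ++ v) = word u * word v.
Proof. exact: big_cat. Qed.

Lemma star_word_cons i u : star (word (i :: u)) = star (word u) * star (t i).
Proof. by rewrite word_cons starM. Qed.

Lemma star_word_mul_cons i j u v :
  star (word (i :: u)) * word (j :: v) = (i == j)%:R *: (star (word u) * word v).
Proof.
rewrite star_word_cons word_cons mulrA -(mulrA _ _ (t j)) t_orth.
by case: eqP => _; rewrite ?mulr1 ?scale1r// mulr0 mul0r scale0r.
Qed.

Lemma star_word_mul u v : size u = size v -> star (word u) * word v = (u == v)%:R.
Proof.
elim: u v => [|i u IH] [|j v] //= => [_|[/IH uv]].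
  by rewrite word_nil star1 mulr1.
rewrite star_word_mul_cons uv eqseq_cons; case: eqP => _; by rewrite ?scale1r ?scale0r.
Qed.

(** Equal leading letters cancel. What survives is the rest of the longer word, or 0 at the first
    disagreement. The lengths are recorded for counting degrees. *)
Lemma star_word_mul_cases u v :
  [\/ exists2 w, (size w <= size v)%N & star (word u) * word v = word w,
      exists2 w, (size w <= size u)%N & star (word u) * word v = star (word w) |
      star (word u) * word v = 0].
Proof.
elim: u v => [|i u IH] v.
  by apply: Or31; exists v; rewrite ?word_nil ?star1 ?mul1r.
case: v => [|j v].
  by apply: Or32; exists (i :: u); rewrite ?word_nil ?mulr1.
rewrite star_word_mul_cons; case: eqP => _; last first.
  by apply: Or33; rewrite scale0r.
rewrite scale1r; case: (IH v) => [[w wv e]|[w wu e]|e].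
- by apply: Or31; exists w => //; apply: leq_trans wv _.
- by apply: Or32; exists w => //; apply: leq_trans wu _.
- exact: Or33.
Qed.

Lemma rnorm_word u : rnorm (word u) <= 1.
Proof. by apply: rnorm_isometry; rewrite star_word_mul// eqxx. Qed.

(** Linear combinations of Wick-ordered monomials; [P] restricts the two lengths, so that bounded
    degree and bihomogeneity are instances of one notion. *)
Inductive wick_span (P : nat -> nat -> bool) : A -> Prop :=
| wick_span0 : wick_span P 0
| wick_span_add c u v a : P (size u) (size v) -> wick_span P a ->
    wick_span P (c *: (word u * star (word v)) + a).

Lemma wick_span_gen P u v : P (size u) (size v) -> wick_span P (word u * star (word v)).
Proof.
by move=> Puv; rewrite -[_ * _]scale1r -[_ *: _]addr0; do 2?constructor.
Qed.

Lemma wick_spanD P a b : wick_span P a -> wick_span P b -> wick_span P (a + b).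
Proof.
by move=> Pa Pb; elim: Pa => [|c u v {}a Puv _ IH]; rewrite ?add0r// -addrA; constructor.
Qed.

Lemma wick_spanZ P c a : wick_span P a -> wick_span P (c *: a).
Proof.
elim=> [|d u v {}a Puv _ IH]; first by rewrite scaler0; constructor.
by rewrite scalerDr scalerA; constructor.
Qed.

Lemma wick_span_sum P J (r : seq J) (F : J -> A) :
  (forall i, wick_span P (F i)) -> wick_span P (\sum_(i <- r) F i).
Proof. by move=> PF; apply: big_ind => //; [constructor|exact: wick_spanD]. Qed.

Lemma wick_span_star P Q a : (forall m n, P m n -> Q n m) ->
  wick_span P a -> wick_span Q (star a).
Proof.
move=> PQ; elim=> [|c u v {}a Puv _ IH]; first by rewrite star0; constructor.
by rewrite starD starZ starM starK; constructor => //; exact: PQ.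
Qed.

Lemma wick_spanM P Q S a b :
  (forall u v u' v', P (size u) (size v) -> Q (size u') (size v') ->
     wick_span S (word u * star (word v) * (word u' * star (word v')))) ->
  wick_span P a -> wick_span Q b -> wick_span S (a * b).
Proof.
move=> PQ Pa; elim: Pa b => [|c u v {}a Puv _ IH] b Qb.
  by rewrite mul0r; constructor.
rewrite mulrDl -scalerAl; apply: wick_spanD; last exact: IH.
apply: wick_spanZ.
elim: Qb => [|d u' v' {}b Quv' _ IHb]; first by rewrite mulr0; constructor.
rewrite mulrDr -scalerAr; apply: wick_spanD IHb.
by apply: wick_spanZ; exact: PQ.
Qed.

Lemma wick_spanW P Q a : (forall m n, P m n -> Q m n) ->
  wick_span P a -> wick_span Q a.
Proof. by move=> PQ; elim=> [|c u v {}a /PQ Puv _ IH]; constructor. Qed.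

Definition degree_le n := wick_span (fun j k => (j <= n)%N && (k <= n)%N).

Lemma degree_leW m n a : (m <= n)%N -> degree_le m a -> degree_le n a.
Proof.
move=> mn; apply: wick_spanW => j k /andP[jm km].
by rewrite !(leq_trans _ mn).
Qed.

Lemma degree_leM m n a b : degree_le m a -> degree_le n b -> degree_le (m + n) (a * b).
Proof.
apply: wick_spanM => u v u' v' /andP[um vm] /andP[u'n v'n].
rewrite mulrA -(mulrA (word u)).
have [[w wv ->]|[w wv ->]|->] := star_word_mul_cases v u'.
- rewrite -word_cat; apply: wick_span_gen; rewrite size_cat.
  by rewrite (leq_add um (leq_trans wv u'n)) (leq_trans v'n)// leq_addl.
- rewrite -mulrA -starM -word_cat; apply: wick_span_gen; rewrite size_cat.
  by rewrite (leq_trans um) ?leq_addr// addnC (leq_add (leq_trans wv vm) v'n).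
- by rewrite mulr0 mul0r; constructor.
Qed.

Lemma degree_le1 : degree_le 0 1.
Proof.
by rewrite -[1]mulr1 -{2}star1 -word_nil; apply: wick_span_gen.
Qed.

Lemma degree_leX n k a : degree_le n a -> degree_le (k * n) (a ^+ k).
Proof.
move=> an; elim: k => [|k IH]; first exact: degree_le1.
by rewrite exprS mulSn; apply: degree_leM.
Qed.

Lemma degree_le_star n a : degree_le n a -> degree_le n (star a).
Proof. by apply: wick_span_star => j k; rewrite andbC. Qed.

Definition homogeneous j k := wick_span (fun j' k' : nat => (j' == j) && (k' == k)).

(** When the inner words have equal length, the monomials multiply like matrix units; in particular
    each [homogeneous k k] is closed under products. *)
Lemma homogeneousM i j k a b :
  homogeneous i j a -> homogeneous j k b -> homogeneous i k (a * b).
Proof.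
apply: wick_spanM => u v u' v' /andP[/eqP ui /eqP vj] /andP[/eqP u'j /eqP v'k].
rewrite mulrA -(mulrA (word u)) star_word_mul ?vj//.
case: eqP => _; last by rewrite mulr0 mul0r; constructor.
by rewrite mulr1; apply: wick_span_gen; rewrite ui v'k !eqxx.
Qed.

Lemma homogeneous_star j k a : homogeneous j k a -> homogeneous k j (star a).
Proof. by apply: wick_span_star => m n; rewrite andbC. Qed.

(** In Fock space, the projection onto the levels from [j] upwards. *)
Definition range_proj j : A := \sum_(u : j.-tuple I) word u * star (word u).

Lemma range_proj0 : range_proj 0 = 1.
Proof.
by rewrite /range_proj (sum_tuple0 (fun u => word u * star (word u))) word_nil star1 mulr1.
Qed.

Lemma range_projS j : range_proj j.+1 = \sum_i t i * range_proj j * star (t i).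
Proof.
rewrite /range_proj (sum_tupleS _ (fun u => word u * star (word u))).
apply: eq_bigr => i _; rewrite mulr_sumr mulr_suml; apply: eq_bigr => u _.
by rewrite word_cons starM !mulrA.
Qed.

Lemma range_proj_mul j i : range_proj j.+1 * t i = t i * range_proj j.
Proof.
rewrite range_projS mulr_suml (bigD1 i)//= big1 ?addr0 => [|k ki].
  by rewrite -mulrA t_orth eqxx mulr1.
by rewrite -mulrA t_orth (negbTE ki) mulr0.
Qed.

Lemma range_projSK j : range_proj j.+1 * range_proj j = range_proj j.+1.
Proof.
elim: j => [|j IH]; first by rewrite range_proj0 mulr1.
rewrite [in X in _ * X = _]range_projS [RHS]range_projS mulr_sumr.
by apply: eq_bigr => i _; rewrite !mulrA range_proj_mul -(mulrA (t i)) IH.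
Qed.

Lemma range_proj_idem j : range_proj j * range_proj j = range_proj j.
Proof.
elim: j => [|j IH]; first by rewrite range_proj0 mulr1.
rewrite [in X in _ * X = _]range_projS [RHS]range_projS mulr_sumr.
by apply: eq_bigr => i _; rewrite !mulrA range_proj_mul -(mulrA (t i)) IH.
Qed.

Lemma star_range_proj j : star (range_proj j) = range_proj j.
Proof. by rewrite star_sum; apply: eq_bigr => u _; rewrite starM starK. Qed.

Lemma rnorm_range_proj j : rnorm (range_proj j) <= 1.
Proof. by apply: rnorm_le1_of_idem; rewrite star_range_proj range_proj_idem. Qed.

End ToeplitzWords.

(** * Norm estimates in the presence of a vacuum vector *)

Section FockVacuum.
Variables (R : realType) (A : cstarAlgebraType R) (H : hilbertType R).
Variables (pi : A -> H -> H) (pi_rep : star_representation pi).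
Variables (I : finType) (t : I -> A).
Hypothesis t_orth : forall i j, star (t i) * t j = (i == j)%:R.
Variable Omega : H.
Hypothesis Omega_norm : vnorm Omega = 1.
Hypothesis Omega_vac : forall i, pi (star (t i)) Omega = 0.
Implicit Types (u v w : seq I) (a b p : A) (x y : H) (c : R[i]) (m : R) (i : I).

Let word := word t.
Let range_proj := range_proj t.

Definition fock_vec u : H := pi (word u) Omega.

Lemma fock_vec_nil : fock_vec [::] = Omega.
Proof. by rewrite /fock_vec /word word_nil star_rep_one. Qed.

Lemma fock_vec_cons i u : fock_vec (i :: u) = pi (t i) (fock_vec u).
Proof. by rewrite /fock_vec /word word_cons star_rep_mul. Qed.

(** Common leading letters cancel; a letter left over on one side moves across as an adjoint and
    kills the vacuum. *)
Lemma inner_fock_vec u v : inner (fock_vec u) (fock_vec v) = (u == v)%:R.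
Proof.
elim: u v => [|i u IH] [|j v].
- by rewrite eqxx fock_vec_nil inner_vnorm Omega_norm expr1n.
- rewrite fock_vec_nil fock_vec_cons -{1}[t j]starK -(pi_adjoint pi_rep).
  by rewrite Omega_vac inner0l.
- rewrite fock_vec_nil fock_vec_cons (pi_adjoint pi_rep).
  by rewrite Omega_vac inner0r.
rewrite !fock_vec_cons (pi_adjoint pi_rep) -star_rep_mul// t_orth eqseq_cons.
case: eqP => _; first by rewrite star_rep_one.
by rewrite (pi0 pi_rep) inner0r.
Qed.

Lemma vnorm_fock_vec u : vnorm (fock_vec u) = 1.
Proof.
have : vnorm (fock_vec u) ^+ 2 = 1.
  by apply: complexI; rewrite -inner_vnorm inner_fock_vec eqxx.
by move/eqP; rewrite sqrp_eq1 ?vnorm_ge0// => /eqP.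
Qed.

Definition level_proj k x : H :=
  \sum_(u : k.-tuple I) inner x (fock_vec u) *: fock_vec u.

Lemma inner_level_proj k x (u : k.-tuple I) :
  inner (level_proj k x) (fock_vec u) = inner x (fock_vec u).
Proof.
rewrite inner_suml (bigD1 u)//= big1 ?addr0 => [|v vu].
  by rewrite innerZl inner_fock_vec eqxx mulr1.
by rewrite innerZl inner_fock_vec (inj_eq val_inj) (negbTE vu) mulr0.
Qed.

(** An orthogonal projection [E] satisfies [inner (E x) (E x) = inner x (E x)]; Cauchy-Schwarz then
    gives the bound. *)
Lemma vnorm_level_proj k x : vnorm (level_proj k x) <= vnorm x.
Proof.
have e : inner (level_proj k x) (level_proj k x) = inner x (level_proj k x).
  rewrite {2 3}/level_proj !inner_sumr; apply: eq_bigr => u _.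
  by rewrite !innerZr inner_level_proj.
have [->|h] := eqVneq (vnorm (level_proj k x)) 0; first exact: vnorm_ge0.
have hp : 0 < vnorm (level_proj k x) by rewrite lt_def h vnorm_ge0.
rewrite -(ler_pM2r hp) -expr2; apply: le_trans (cauchy_schwarz _ _).
rewrite -lecR -inner_vnorm e -normcC real_ler_norm// -e inner_vnorm.
by apply/complex_realP; eexists.
Qed.

Lemma level_proj_fock_vec k (u : k.-tuple I) : level_proj k (fock_vec u) = fock_vec u.
Proof.
rewrite /level_proj (bigD1 u)//= big1 ?addr0 => [|v vu].
  by rewrite inner_fock_vec eqxx scale1r.
by rewrite inner_fock_vec (inj_eq val_inj) eq_sym (negbTE vu) scale0r.
Qed.

(* The matrix of [pi p] between the levels [k] and [j] of Fock space, transplanted into the matrix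
   units [word u * star (word v)] of [A]. *)
Definition symbol j k p : A :=
  \sum_(u : j.-tuple I) \sum_(v : k.-tuple I)
    inner (pi p (fock_vec v)) (fock_vec u) *: (word u * star (word v)).

Lemma symbol_linear j k c a b : symbol j k (c *: a + b) = c *: symbol j k a + symbol j k b.
Proof.
rewrite /symbol scaler_sumr -big_split/=; apply: eq_bigr => u _.
rewrite scaler_sumr -big_split/=; apply: eq_bigr => v _.
by rewrite star_rep_lin// innerDl innerZl scalerDl scalerA.
Qed.

Lemma symbol0 j k : symbol j k 0 = 0.
Proof. by have := symbol_linear j k (-1) 0 0; rewrite !scaleN1r !addNr; apply. Qed.

Lemma star_symbol j k p : star (symbol j k p) = symbol k j (star p).
Proof.
rewrite /symbol star_sum; under eq_bigr do rewrite star_sum.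
rewrite exchange_big/=; apply: eq_bigr => u _; apply: eq_bigr => v _.
by rewrite starZ starM starK -innerC (pi_adjoint pi_rep) starK.
Qed.

(** Only rows whose word starts with [i] contribute, since the other letters have ranges orthogonal
    to that of [t i]. *)
Lemma symbol_consl j k i p : symbol j.+1 k (t i * p) = t i * symbol j k p.
Proof.
rewrite /symbol (sum_tupleS _ (fun u => \sum_(v : k.-tuple I)
    inner (pi (t i * p) (fock_vec v)) (fock_vec u) *: (word u * star (word v)))).
rewrite (bigD1 i)//= [X in _ + X]big1 ?addr0.
  rewrite mulr_sumr; apply: eq_bigr => u _; rewrite mulr_sumr; apply: eq_bigr => v _.
  rewrite star_rep_mul// fock_vec_cons (pi_adjoint pi_rep) -star_rep_mul// t_orth eqxx.
  by rewrite star_rep_one// /word word_cons -scalerAr mulrA.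
move=> i' ii'; rewrite big1// => u _; rewrite big1// => v _.
rewrite star_rep_mul// fock_vec_cons (pi_adjoint pi_rep) -star_rep_mul// t_orth eq_sym.
by rewrite (negbTE ii') (pi0 pi_rep) inner0r scale0r.
Qed.

Lemma symbol_consr j k i p : symbol j k.+1 (p * star (t i)) = symbol j k p * star (t i).
Proof.
apply: (can_inj (@starK _ A)); rewrite star_symbol starM starK symbol_consl.
by rewrite starM starK star_symbol.
Qed.

Lemma symbol0_consl k i p : symbol 0 k (t i * p) = 0.
Proof.
rewrite /symbol big1// => u _; rewrite big1// => v _.
rewrite [u]tuple0 fock_vec_nil star_rep_mul// (pi_adjoint pi_rep) Omega_vac.
by rewrite inner0r scale0r.
Qed.

Lemma symbol0_consr j i p : symbol j 0 (p * star (t i)) = 0.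
Proof.
by apply: (can_inj (@starK _ A)); rewrite star_symbol starM starK symbol0_consl star0.
Qed.

Lemma symbol1 j k : symbol j k 1 = if j == k then range_proj j else 0.
Proof.
case: eqP => [<-|jk].
  apply: eq_bigr => u _; rewrite (bigD1 u)//= big1 ?addr0 => [|v vu].
    by rewrite star_rep_one// inner_fock_vec eqxx scale1r.
  by rewrite star_rep_one// inner_fock_vec (inj_eq val_inj) (negbTE vu) scale0r.
rewrite /symbol big1// => u _; rewrite big1// => v _.
rewrite star_rep_one// inner_fock_vec; case: eqP => [vu|]; rewrite ?scale0r//.
by case: jk; rewrite -(size_tuple u) -vu size_tuple.
Qed.

(** Letters are stripped from [u] and then from [v], until [symbol 0 0 1 = 1] remains. *)
Lemma symbol_matrix_unit u v :
  symbol (size u) (size v) (word u * star (word v)) = word u * star (word v).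
Proof.
elim: u => [|i u IH]; last by rewrite /word word_cons -mulrA symbol_consl IH.
elim: v => [|i v IH].
  by rewrite /word word_nil star1 mulr1 symbol1 /= /range_proj range_proj0.
rewrite /word star_word_cons mulrA symbol_consr.
by move: IH; rewrite /word /= => ->.
Qed.

Lemma symbol_homogeneous j k a : homogeneous t j k a -> symbol j k a = a.
Proof.
elim=> [|c u v {}a /andP[/eqP uj /eqP vk] _ IH]; first exact: symbol0.
by rewrite symbol_linear IH -{1}uj -{1}vk symbol_matrix_unit.
Qed.

Lemma homogeneous_symbol j k p : homogeneous t j k (symbol j k p).
Proof.
apply: wick_span_sum => u; apply: wick_span_sum => v; apply: wick_spanZ.
by apply: wick_span_gen; rewrite !size_tuple !eqxx.
Qed.

(** The element is the sum of its matrix coefficients, each at most [m], times matrix units of norm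
    at most 1. The dimension factor is removed in [rnorm_symbol]. *)
Lemma rnorm_homogeneous_crude j k a m : homogeneous t j k a ->
  (forall v : k.-tuple I, vnorm (pi a (fock_vec v)) <= m) ->
  rnorm a <= (#|{: j.-tuple I}| * #|{: k.-tuple I}|)%:R * m.
Proof.
move=> ajk am; rewrite -{1}(symbol_homogeneous ajk).
rewrite mulr_natl mulnC mulrnA -!sumr_const.
apply: le_trans (rnorm_sum _ _) _; apply: ler_sum => u _.
apply: le_trans (rnorm_sum _ _) _; apply: ler_sum => v _.
rewrite rnormZ; apply: le_trans (ler_piMr _ _) _.
- by rewrite -lecR -normcC normr_ge0.
- apply: le_trans (rnormM _ _) _; rewrite rnorm_star -[leRHS]mul1r.
  by apply: ler_pM; rewrite ?rnorm_ge0 ?rnorm_word.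
- by apply: le_trans (cauchy_schwarz _ _) _; rewrite vnorm_fock_vec mulr1.
Qed.

(** Applied to [fock_vec v], only the matrix units with column [v] survive; hence the symbol acts on
    level [k] as a compression of [pi p]. *)
Lemma pi_symbol_level j k p x :
  pi (symbol j k p) (level_proj k x) = level_proj j (pi p (level_proj k x)).
Proof.
have e (v : k.-tuple I) : pi (symbol j k p) (fock_vec v) = level_proj j (pi p (fock_vec v)).
  rewrite /symbol (pi_sum pi_rep); apply: eq_bigr => u _.
  rewrite (pi_sum pi_rep) (bigD1 v)//= big1 ?addr0 => [|v' vv'].
    rewrite (piZ pi_rep) {3}/fock_vec -star_rep_mul// -mulrA /word.
    by rewrite star_word_mul// eqxx mulr1.
  rewrite (piZ pi_rep) {3}/fock_vec -star_rep_mul// -mulrA /word.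
  rewrite star_word_mul ?size_tuple// (inj_eq val_inj) (negbTE vv').
  by rewrite mulr0 (pi0 pi_rep) scaler0.
have level_linear c y z : level_proj j (c *: y + z) = c *: level_proj j y + level_proj j z.
  rewrite /level_proj scaler_sumr -big_split/=; apply: eq_bigr => u _.
  by rewrite innerDl innerZl scalerDl scalerA.
rewrite {1 3}/level_proj; apply: (big_ind (fun y =>
  pi (symbol j k p) y = level_proj j (pi p y))) => [|y z|v _].
- rewrite !(pi_v0 pi_rep) /level_proj big1// => u _; by rewrite inner0l scale0r.
- by rewrite !(pi_vD pi_rep) => -> ->; rewrite -{2}[pi p y]scale1r level_linear scale1r.
rewrite !(pi_vZ pi_rep) e -[_ *: pi p _]addr0 level_linear.
by rewrite [X in _ + X]big1 ?addr0// => u _; rewrite inner0l scale0r.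
Qed.

(** All positive powers of [star Y * Y] stay in the matrix algebra [homogeneous k k], so the crude
    constant is the same for all of them and taking roots removes it. *)
Lemma rnorm_symbol j k p m : 0 <= m -> rep_bound pi p m -> rnorm (symbol j k p) <= m.
Proof.
move=> m0 pm; set Y := symbol j k p.
have sm := rep_bound_star pi_rep pm.
(* The image is again written as a vector of level [k], so that the estimate can be iterated. *)
have step x : exists y, pi (star Y * Y) (level_proj k x) = level_proj k y /\
    vnorm (level_proj k y) <= m ^+ 2 * vnorm (level_proj k x).
  exists (pi (star p) (level_proj j (pi p (level_proj k x)))); split.
    by rewrite star_rep_mul// pi_symbol_level star_symbol pi_symbol_level.
  apply: le_trans (vnorm_level_proj _ _) _; apply: le_trans (sm _) _.
  rewrite expr2 -mulrA ler_wpM2l//.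
  by apply: le_trans (vnorm_level_proj _ _) _; exact: pm.
have steps n x : exists y, pi ((star Y * Y) ^+ n) (level_proj k x) = level_proj k y /\
    vnorm (level_proj k y) <= (m ^+ 2) ^+ n * vnorm (level_proj k x).
  elim: n => [|n [y [e ym]]]; first by exists x; rewrite star_rep_one// mul1r.
  have [z [ez zm]] := step y; exists z; rewrite exprS star_rep_mul// e; split => //.
  by apply: le_trans zm _; rewrite [(m ^+ 2) ^+ _]exprS -mulrA ler_wpM2l ?exprn_ge0.
(* The exponent is a successor because the power 0 is [1], which need not lie in
   [homogeneous k k]. *)
have YX n : homogeneous t k k ((star Y * Y) ^+ n.+1).
  have YY : homogeneous t k k (star Y * Y).
    apply: (@homogeneousM _ _ _ _ t_orth _ j); last exact: homogeneous_symbol.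
    exact/homogeneous_star/homogeneous_symbol.
  elim: n => [//|n IH]; rewrite exprS; exact: (homogeneousM t_orth YY IH).
apply: (@rnorm_le_of_powers _ _ _ _ (#|{: k.-tuple I}| * #|{: k.-tuple I}|)%:R 1) => // n.
rewrite expr1n mulr1; apply: rnorm_homogeneous_crude.
  have -> : (2 ^ n = (2 ^ n).-1.+1)%N by rewrite prednK// expn_gt0.
  exact: YX.
move=> v; have [y [e ym]] := steps (2 ^ n)%N (fock_vec v).
rewrite level_proj_fock_vec in e ym; rewrite e.
by move: ym; rewrite vnorm_fock_vec mulr1.
Qed.

(* On a matrix unit [word u * star (word v)], [symbol j k] is nonzero as soon as
   (j, k) = (size u + i, size v + i) for some i; the second term removes the contributions with
   i > 0. *)
Definition wick_part j k p : A :=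
  symbol j k p -
  (if (j, k) is (j'.+1, k'.+1) then range_proj j * symbol j' k' p else 0).

Lemma wick_part_linear j k c a b :
  wick_part j k (c *: a + b) = c *: wick_part j k a + wick_part j k b.
Proof.
rewrite /wick_part !symbol_linear; case: j => [|j]; first by rewrite !subr0.
case: k => [|k]; first by rewrite !subr0.
by rewrite symbol_linear mulrDr -scalerAr scalerBr opprD addrACA.
Qed.

(** The correction term obeys the same rule as [symbol], because [range_proj j.+1 * t i = t i *
    range_proj j]. *)
Lemma wick_part_consl j k i p : wick_part j.+1 k (t i * p) = t i * wick_part j k p.
Proof.
rewrite /wick_part symbol_consl mulrBr; congr (_ - _).
case: k => [|k]; first by case: j => [|j]; rewrite mulr0.
case: j => [|j]; first by rewrite symbol0_consl !mulr0.
by rewrite symbol_consl mulrA /range_proj range_proj_mul// mulrA.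
Qed.

Lemma wick_part0_consl k i p : wick_part 0 k (t i * p) = 0.
Proof. by rewrite /wick_part symbol0_consl subr0. Qed.

Lemma wick_part_consr j k i p :
  wick_part j k.+1 (p * star (t i)) = wick_part j k p * star (t i).
Proof.
rewrite /wick_part symbol_consr mulrBl; congr (_ - _).
case: j => [|j]; first by rewrite mul0r.
case: k => [|k]; first by rewrite symbol0_consr mulr0 mul0r.
by rewrite symbol_consr mulrA.
Qed.

Lemma wick_part0_consr j i p : wick_part j 0 (p * star (t i)) = 0.
Proof. by rewrite /wick_part symbol0_consr; case: j => [|j]; rewrite subr0. Qed.

(** On a diagonal block of positive level the two terms are [range_proj j.+1] and
    [range_proj j.+1 * range_proj j], which agree since the range projections decrease. *)
Lemma wick_part1 j k : wick_part j k 1 = ((j == 0%N) && (k == 0%N))%:R.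
Proof.
rewrite /wick_part symbol1; case: j => [|j].
  by case: k => [|k]; rewrite /= subr0 ?[range_proj _]range_proj0.
case: k => [|k]; first by rewrite subr0.
rewrite symbol1 eqSS; case: eqP => _ /=; last by rewrite mulr0 subr0.
by rewrite /range_proj range_projSK// subrr.
Qed.

Lemma wick_part_matrix_unit j k u v :
  wick_part j k (word u * star (word v)) =
  ((size u == j) && (size v == k))%:R *: (word u * star (word v)).
Proof.
elim: u j => [|i u IH] j; last first.
  rewrite /word word_cons -mulrA; case: j => [|j].
    by rewrite wick_part0_consl scale0r.
  by rewrite wick_part_consl IH -scalerAr.
elim: v k => [|i v IH] k.
  rewrite /word word_nil star1 mulr1 wick_part1 /= [0%N == j]eq_sym [0%N == k]eq_sym.
  by case: (_ && _); rewrite ?scale1r ?scale0r.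
rewrite /word star_word_cons mulrA; case: k => [|k].
  by rewrite wick_part0_consr andbF scale0r.
by rewrite wick_part_consr; move: (IH k); rewrite /word => ->; rewrite -scalerAl.
Qed.

Lemma sum_wick_part n p : degree_le t n p ->
  \sum_(j < n.+1) \sum_(k < n.+1) wick_part j k p = p.
Proof.
elim=> [|c u v {}p /andP[un vn] _ IH].
  rewrite big1// => j _; rewrite big1// => k _.
  have := wick_part_linear j k (-1) 0 0; rewrite !scaleN1r !addNr; apply.
have uo : (size u < n.+1)%N by []. have vo : (size v < n.+1)%N by [].
under eq_bigr do under eq_bigr do rewrite wick_part_linear.
under eq_bigr do rewrite big_split/=.
rewrite big_split/= IH; congr (_ + _).
rewrite (bigD1 (Ordinal uo))//= [X in _ + X]big1 ?addr0 => [|j ju].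
  rewrite (bigD1 (Ordinal vo))//= [X in _ + X]big1 ?addr0 => [|k kv].
    by rewrite wick_part_matrix_unit !eqxx scale1r.
  rewrite wick_part_matrix_unit [_ == k :> nat]eq_sym -(inj_eq val_inj)/= in kv *.
  by rewrite (negbTE kv) andbF scale0r scaler0.
rewrite big1// => k _; rewrite wick_part_matrix_unit [_ == j :> nat]eq_sym.
by rewrite -(inj_eq val_inj)/= in ju; rewrite (negbTE ju) scale0r scaler0.
Qed.

Lemma rnorm_wick_part j k p m : 0 <= m -> rep_bound pi p m -> rnorm (wick_part j k p) <= 2 * m.
Proof.
move=> m0 pm; apply: le_trans (rnormB _ _) _; rewrite mulr2n mulrDl mul1r.
apply: lerD; first exact: rnorm_symbol.
case: j => [|j]; first by rewrite rnorm0.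
case: k => [|k]; first by rewrite rnorm0.
apply: le_trans (rnormM _ _) _; rewrite -[m]mul1r.
by apply: ler_pM; rewrite ?rnorm_ge0 ?rnorm_range_proj ?rnorm_symbol.
Qed.

Lemma rnorm_degree_crude n p m : 0 <= m -> degree_le t n p -> rep_bound pi p m ->
  rnorm p <= 2 * n.+1%:R ^+ 2 * m.
Proof.
move=> m0 pn pm; rewrite -{1}(sum_wick_part pn).
have -> : 2 * n.+1%:R ^+ 2 * m = \sum_(j < n.+1) \sum_(k < n.+1) 2 * m.
  rewrite !sumr_const !card_ord -[RHS]mulr_natr -[in RHS]mulr_natr.
  by move: (_%:R : R) => N; ring.
apply: le_trans (rnorm_sum _ _) _; apply: ler_sum => j _.
apply: le_trans (rnorm_sum _ _) _; apply: ler_sum => k _.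
exact: rnorm_wick_part.
Qed.

Lemma rnorm_le_rep_bound n p m : 0 <= m -> degree_le t n p -> rep_bound pi p m -> rnorm p <= m.
Proof.
move=> m0 pn pm.
(* The power [2 ^ k] of [star p * p] has degree at most [2 ^ k * (2 * n)], and [2 ^ k * (2 * n) + 1
   <= 2 ^ k * (2 * n + 1)]; squaring gives the growth rate 4. *)
apply: (@rnorm_le_of_powers _ _ _ _ (2 * (2 * n).+1%:R ^+ 2) 4) => // [|k].
  by rewrite ler1n.
have pk : degree_le t (2 ^ k * (n + n)) ((star p * p) ^+ (2 ^ k)).
  apply: (degree_leX t_orth); apply: (degree_leM t_orth) => //; exact: degree_le_star.
have bk : rep_bound pi ((star p * p) ^+ (2 ^ k)) ((m ^+ 2) ^+ (2 ^ k)).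
  apply: rep_boundX => //; first exact: exprn_ge0.
  by rewrite expr2; apply: rep_boundM => //; exact: rep_bound_star.
apply: le_trans (rnorm_degree_crude _ pk bk) _; first by rewrite !exprn_ge0.
apply: ler_wpM2r; first by rewrite !exprn_ge0.
rewrite -mulrA; apply: ler_wpM2l => //.
have -> : (4 : R) ^+ k = ((2 ^ k)%:R) ^+ 2.
  by rewrite natrX -exprM mulnC exprM; congr (_ ^+ _); rewrite expr2 -natrM.
rewrite -exprMn -natrM ler_pXn2r ?nnegrE ?ler0n// ler_nat.
by rewrite addnn -mul2n mulnC mulSn -add1n leq_add2r expn_gt0.
Qed.

End FockVacuum.

(** * Density and the reduction to q = 0 *)

Section Density.
Variables (R : realType) (A : cstarAlgebraType R) (I : finType) (t : I -> A).
Hypothesis t_orth : forall i j, star (t i) * t j = (i == j)%:R.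
Implicit Types (a b p : A).

(** The norm closure of the Wick polynomials in [t], spelled out with real tolerances. *)
Definition wick_closure : set A :=
  [set a | forall e : R, 0 < e -> exists n p, degree_le t n p /\ rnorm (a - p) < e].

Lemma wick_closure_poly n p : degree_le t n p -> wick_closure p.
Proof. by move=> pn e e0; exists n, p; rewrite subrr rnorm0. Qed.

Lemma degree_le_gen i : degree_le t 1 (t i).
Proof.
have := @wick_span_gen _ _ _ t (fun j k => (j <= 1)%N && (k <= 1)%N) [:: i] [::] isT.
by rewrite word_cons word_nil star1 !mulr1.
Qed.

Lemma degree_leD m n a b : degree_le t m a -> degree_le t n b ->
  degree_le t (maxn m n) (a + b).
Proof.
move=> am bn; apply: wick_spanD.
  by apply: degree_leW am; exact: leq_maxl.
by apply: degree_leW bn; exact: leq_maxr.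
Qed.

Lemma wick_closure_subalgebra : cstar_subalgebra wick_closure.
Proof.
split.
- move=> a acl e e0.
  have e2 : 0 < e / 2 by rewrite divr_gt0.
  have /acl[b [/(_ _ e2)[n [p [pn bp]]]]] :
      nbhs (a : normed_space A) (ball (a : normed_space A) (e / 2)%:C%C).
    by apply: nbhsx_ballx; rewrite ltcR.
  rewrite -ball_normE/= => ab.
  have {}ab : rnorm (a - b) < e / 2 by move: ab; rewrite -ltcR -rnormE.
  exists n, p; split => //; rewrite -[a - p](subrKA b) (splitr e).
  by apply: le_lt_trans (rnormD _ _) _; exact: ltrD.
- exact: wick_closure_poly (degree_le1 t).
- move=> c a b aS bS e e0.
  have c0 : 0 <= normc c by rewrite -lecR -normcC normr_ge0.
  have [|m [p [pm ap]]] := aS (e / 2 / (1 + normc c)).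
    by rewrite !divr_gt0// ltr_wpDr.
  have [|n [r [rn br]]] := bS (e / 2); first by rewrite divr_gt0.
  exists (maxn m n), (c *: p + r); split.
    by apply: degree_leD => //; apply: wick_spanZ.
  rewrite opprD addrACA -scalerBr (splitr e).
  apply: le_lt_trans (rnormD _ _) _; apply: ler_ltD => //.
  rewrite rnormZ; apply: le_trans (ler_wpM2l c0 (ltW ap)) _.
  rewrite mulrCA ler_piMr//; first by rewrite ltW// divr_gt0.
  by rewrite ler_pdivrMr ?mul1r ?lerDr// ltr_wpDr.
- move=> a b aS bS e e0.
  (* The approximant [r] of [b] is fixed first: the precision required for [a] depends on its
     norm. *)
  have [|n [r [rn br]]] := bS (e / 2 / (1 + rnorm a)).
    by rewrite !divr_gt0// ltr_wpDr// rnorm_ge0.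
  have [|m [p [pm ap]]] := aS (e / 2 / (1 + rnorm r)).
    by rewrite !divr_gt0// ltr_wpDr// rnorm_ge0.
  exists (m + n)%N, (p * r); split; first exact: degree_leM.
  have -> : a * b - p * r = a * (b - r) + (a - p) * r.
    by rewrite mulrBr mulrBl addrA subrK.
  rewrite (splitr e); apply: le_lt_trans (rnormD _ _) _; apply: ler_ltD.
    apply: le_trans (rnormM _ _) _.
    apply: le_trans (ler_wpM2l (rnorm_ge0 _) (ltW br)) _.
    rewrite mulrCA ler_piMr//; first by rewrite ltW// divr_gt0.
    by rewrite ler_pdivrMr ?mul1r ?lerDr// ltr_wpDr// rnorm_ge0.
  apply: le_lt_trans (rnormM _ _) _.
  apply: (@le_lt_trans _ _ (rnorm (a - p) * (1 + rnorm r))).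
    by rewrite ler_wpM2l ?rnorm_ge0// lerDr.
  by rewrite -ltr_pdivlMr// ltr_wpDr// rnorm_ge0.
- move=> a aS e /aS[n [p [pn ap]]]; exists n, (star p).
  by split; [exact: degree_le_star | rewrite -starB rnorm_star].
Qed.

End Density.

(** * Faithfulness for isometries with orthogonal ranges *)

Section ToeplitzFaithful.
Variables (R : realType) (A : cstarAlgebraType R) (H : hilbertType R).
Variables (pi : A -> H -> H) (pi_rep : star_representation pi).
Variables (I : finType) (t : I -> A).
Hypothesis t_orth : forall i j, star (t i) * t j = (i == j)%:R.
Hypothesis t_dense : wick_closure t = setT.

(** If [pi] kills [a - b], a polynomial [p] within [e / 2] of it has [pi p] bounded by [e / 2].
    Hence [p] has norm at most [e / 2], and [a - b] at most [e]. *)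
Theorem toeplitz_vacuum_faithful (Omega : H) : Omega != 0 ->
  (forall i, pi (star (t i)) Omega = 0) -> injective pi.
Proof.
move=> O0 Ovac a b ab.
pose Omega1 := ((vnorm Omega)^-1)%:C%C *: Omega.
have nO : 0 < vnorm Omega.
  rewrite lt_def vnorm_ge0 andbT; apply: contra O0 => /eqP h.
  by rewrite (vnorm_eq0 h).
have O1 : vnorm Omega1 = 1.
  rewrite vnormZ.
  have -> : normc ((vnorm Omega)^-1)%:C%C = (vnorm Omega)^-1.
    by apply: complexI; rewrite -normcC ger0_norm// ler0c invr_ge0 ltW.
  by rewrite mulVf// gt_eqF.
have Ovac1 i : pi (star (t i)) Omega1 = 0.
  by rewrite (pi_vZ pi_rep) Ovac scaler0.
apply/eqP; rewrite -subr_eq0; apply/eqP/rnorm0_eq0/eqP.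
rewrite eq_le rnorm_ge0 andbT; apply/ler_addgt0Pr => e e0; rewrite add0r.
have e2 : 0 < e / 2 by rewrite divr_gt0.
have : wick_closure t (a - b) by rewrite t_dense.
move=> /(_ _ e2)[n [p [pn dp]]].
have pe : rep_bound pi p (e / 2).
  move=> x; have -> : pi p x = pi (p - (a - b)) x.
    by rewrite !(piB pi_rep) ab subrr subr0.
  apply: le_trans (rep_bound_rnorm pi_rep _ _) _.
  by rewrite ler_wpM2r ?vnorm_ge0// -opprB rnormN ltW.
have := rnorm_le_rep_bound pi_rep t_orth O1 Ovac1 (ltW e2) pn pe => pe2.
rewrite -[a - b](subrK p) (splitr e); apply: le_trans (rnormD _ _) _.
by rewrite lerD// ltW.
Qed.

End ToeplitzFaithful.

(** * Untwisting the relation with parameter q *)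

Section Untwist.
Variables (R : realType) (q : R[i]) (A : cstarAlgebraType R) (s1 s2 : A).
Hypotheses (q_lt1 : `|q| < 1) (s_rel : q_isometries q s1 s2).

Let P : A := s1 * star s1.
(** This element acts as 1 on [1 - P] and as [1 + c] on [P], so computing with such elements is
    scalar arithmetic. *)
Let aff (c : R[i]) : A := 1 + c *: P.

Let lam : R[i] := sqrtC (1 - `|q| ^+ 2).

(* [star s2 * (1 - P) * s2 = 1 - |q|^2 P], and [aff (lam^-1 - 1)] is its inverse square root. *)
Definition untwisted (b : bool) : A := if b then s1 else (1 - P) * s2 * aff (lam^-1 - 1).

Let s11 : star s1 * s1 = 1. Proof. by case: s_rel. Qed.
Let s22 : star s2 * s2 = 1. Proof. by case: s_rel. Qed.
Let s12 : star s1 * s2 = q *: (s2 * star s1). Proof. by case: s_rel. Qed.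
Let s21 : star s2 * s1 = q^* *: (s1 * star s2).
Proof. by rewrite -[s1 in LHS]starK -starM s12 starZ starM starK. Qed.

Let PP : P * P = P.
Proof. by rewrite /P mulrA -(mulrA s1) s11 mulr1. Qed.

Let starP : star P = P.
Proof. by rewrite starM starK. Qed.

Let star1P : star (1 - P) = 1 - P.
Proof. by rewrite starB star1 starP. Qed.

Let P1P : (1 - P) * (1 - P) = 1 - P.
Proof. by rewrite mulrBr mulr1 mulrBl mul1r PP subrr subr0. Qed.

Let affM c d : aff c * aff d = aff (c + d + c * d).
Proof.
rewrite /aff mulrDl mul1r mulrDr mulr1 -scalerAl -scalerAr PP scalerA.
by rewrite !scalerDl -!addrA; congr (_ + _); rewrite addrCA.
Qed.

Let aff0 : aff 0 = 1.
Proof. by rewrite /aff scale0r addr0. Qed.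

Let star_aff c : c^* = c -> star (aff c) = aff c.
Proof. by move=> cr; rewrite /aff starD starZ star1 starP cr. Qed.

Let lam_gt0 : 0 < lam.
Proof. by rewrite sqrtC_gt0 subr_gt0 expr_lt1. Qed.

Let lamJ : lam^* = lam.
Proof. by apply/CrealP; rewrite gtr0_real. Qed.

(** Moving both factors [s2] across [s1] turns [star s2 * P * s2] into [|q|^2 P]. *)
Let s2_defect : star s2 * (1 - P) * s2 = aff (- `|q| ^+ 2).
Proof.
rewrite mulrBr mulr1 mulrBl s22 /P mulrA s21 -mulrA s12.
rewrite -scalerAl -scalerAr !scalerA mulrA -(mulrA s1) s22 mulr1.
by rewrite /aff scaleNr normCK mulrC.
Qed.

(** Mixed products vanish because [star s1 * (1 - P) = 0]; for the second generator, the outer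
    factors invert [s2_defect]. *)
Lemma untwisted_orth b b' : star (untwisted b) * untwisted b' = (b == b')%:R.
Proof.
have s1P : star s1 * (1 - P) = 0 by rewrite mulrBr mulr1 /P mulrA s11 mul1r subrr.
case: b; case: b' => //=.
- by rewrite !mulrA s1P !mul0r.
- by rewrite -[s1]starK -starM !mulrA s1P !mul0r star0.
rewrite !starM star1P star_aff; last by rewrite rmorphB rmorph1 fmorphV/= lamJ.
set a := aff _.
have -> : a * (star s2 * (1 - P)) * ((1 - P) * s2 * a) =
    a * (star s2 * ((1 - P) * (1 - P)) * s2) * a.
  by rewrite !mulrA.
rewrite P1P s2_defect !affM -[RHS]aff0; congr aff.
have -> : `|q| ^+ 2 = 1 - lam ^+ 2 by rewrite sqrtCK subKr.
by field; rewrite gt_eqF.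
Qed.

(** [1 - P] fixes the vacuum because [star s1] kills it; [star s2] kills it next. *)
Lemma untwisted_vacuum (H : hilbertType R) (pi : A -> H -> H) (Omega : H) :
  star_representation pi -> pi (star s1) Omega = 0 -> pi (star s2) Omega = 0 ->
  forall b, pi (star (untwisted b)) Omega = 0.
Proof.
move=> rep O1 O2 [//|] /=; rewrite !starM star1P !star_rep_mul//.
have -> : pi (1 - P) Omega = Omega.
  by rewrite (piB rep) star_rep_one// star_rep_mul// O1 (pi_v0 rep) subr0.
by rewrite O2 (pi_v0 rep).
Qed.

Lemma untwisted_generate : cstar_generated s1 s2 -> wick_closure untwisted = setT.
Proof.
apply; first exact: wick_closure_subalgebra untwisted_orth.
  exact: wick_closure_poly (degree_le_gen untwisted true).
pose w := untwisted false * aff (lam - 1).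
(* Here [w = (1 - P) * s2], and [P * s2] is rewritten by the relation. Thus [s2] is a fixed point of
   [x |-> w + q *: (s1 * x * star s1)], a contraction of ratio [|q|]. *)
have s2E : s2 = w + q *: (s1 * s2 * star s1).
  have -> : w = (1 - P) * s2.
    rewrite /w /untwisted -[LHS]mulrA affM -[RHS]mulr1 -aff0; congr (_ * aff _).
    by field; rewrite gt_eqF.
  have -> : q *: (s1 * s2 * star s1) = P * s2 by rewrite -mulrA scalerAr -s12 mulrA.
  by rewrite -mulrDl subrK mul1r.
have d1 := degree_le_gen untwisted true; rewrite /= in d1.
have dM := degree_leM untwisted_orth.
have ds := degree_le_star d1.
have [k dw] : exists k, degree_le untwisted k w.
  have := dM _ _ _ _ (degree_le_gen untwisted false)
    (degree_leD (degree_le1 untwisted) (wick_spanZ (lam - 1) (dM _ _ _ _ d1 ds))).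
  by eexists; eassumption.
(* The iterates of this contraction from 0 are polynomials in the untwisted generators, and their
   distance to [s2] decays geometrically. *)
have approx n : exists m p, degree_le untwisted m p /\ rnorm (s2 - p) <= rnorm s2 * normc q ^+ n.
  elim: n => [|n [m [p [pm ps]]]].
    by exists 0%N, 0; rewrite subr0 mulr1; split => //; constructor.
  eexists; exists (w + q *: (s1 * p * star s1)); split.
    by apply: degree_leD dw _; apply: wick_spanZ; exact: (dM _ _ _ _ (dM _ _ _ _ d1 pm) ds).
  rewrite {1}s2E opprD addrACA subrr add0r -scalerBr -mulrBl -mulrBr rnormZ.
  rewrite exprS mulrCA; apply: ler_wpM2l.
    by rewrite -lecR -normcC normr_ge0.
  apply: le_trans ps.
  have i1 := rnorm_isometry s11.
  apply: le_trans (rnormM _ _) _; rewrite rnorm_star -[leRHS]mulr1.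
  apply: ler_pM => //; rewrite ?rnorm_ge0//.
  apply: le_trans (rnormM _ _) _; rewrite -[leRHS]mul1r.
  by apply: ler_pM => //; rewrite ?rnorm_ge0.
move=> e e0.
have [|||N /(_ N (leqnn N)) eN] := @exists_geometric_lt R (rnorm s2) (normc q) e.
- by rewrite -lecR -normcC normr_ge0.
- by rewrite -ltcR -normcC.
- by [].
have [m [p [pm ps]]] := approx N.
by exists m, p; split => //; apply: le_lt_trans ps eN.
Qed.

End Untwist.

Theorem proposition1 (R : realType) (q : R[i]) (q_lt1 : `|q| < 1)
    (A : cstarAlgebraType R) (s1 s2 : A) (A_O2q : is_O2q q s1 s2)
    (H : hilbertType R) (pi : A -> H -> H)
    (pi_Fock : is_Fock_representation s1 s2 pi) :
  faithful_rep pi.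
Proof.
case: A_O2q => s_rel s_gen _; case: pi_Fock => pi_rep _ [vac [vac0 vac1 vac2]].
apply: (toeplitz_vacuum_faithful pi_rep (untwisted_orth q_lt1 s_rel) _ vac0).
  exact: untwisted_generate.
exact: untwisted_vacuum.
Qed.
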